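(* The family $\Phi^{\mathbf m,\mathbf n}=[\Phi_{i,j} : (i,j)\in G_{\mathbf m,\mathbf n}]$ is a basis for the space $S_{\mathbf m,\mathbf n}$, and it is dual to the family of functionals $\Lambda_{\mathbf m,\mathbf n}=[\lambda_i^{m_r}\times\lambda_j^{n_r} : (i,j)\in G_{\mathbf m,\mathbf n}]$; that is, $(\lambda_i^{m_r}\times\lambda_j^{n_r})\Phi_{p,q}=\delta_{i,p}\,\delta_{j,q}$ for all $(i,j),(p,q)\in G_{\mathbf m,\mathbf n}$.
   Context: Fix an integer $r\ge 0$, real intervals $[a,b]$ and $[c,d]$ with $a<b$, $c<d$, and strictly increasing sequences $\mathbf m=[m_0,\dots,m_r]$, $\mathbf n=[n_0,\dots,n_r]$ of positive integers with $m_k\mid m_{k+1}$ and $n_k\mid n_{k+1}$ for $0\le k\le r-1$. $\Pi_N$ is the space of real univariate polynomials of degree at most $N$; $\Pi_M\otimes\Pi_N$ is the span of the bivariate monomials $x^iy^j$, $0\le i\le M$, $0\le j\le N$. Quantities with superscript/subscript $m_k$ refer to the first variable and the interval $[a,b]$; those with $n_k$ refer to the second variable and the interval $[c,d]$. Approximating space: $S_{\mathbf m,\mathbf n}=\sum_{k=0}^r \Pi_{m_k}\otimes\Pi_{n_{r-k}}$. Grid: $\alpha^k_i=i\,m_r/m_k$ for $0\le i\le m_k$ and $\beta^k_j=j\,n_r/n_k$ for $0\le j\le n_k$ (integers); $\mathrm{Ran}(\alpha^k)=\{\alpha^k_0,\dots,\alpha^k_{m_k}\}$, $\mathrm{Ran}(\beta^k)=\{\beta^k_0,\dots,\beta^k_{n_k}\}$.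 The quasi-uniform set is $G_{\mathbf m,\mathbf n}=\bigcup_{k=0}^r\{(\alpha^k_i,\beta^{r-k}_j): 0\le i\le m_k,\ 0\le j\le n_{r-k}\}$. Functionals: for $N=m_k$, let $B_i^N(x)=\binom{N}{i}\left(\frac{b-x}{b-a}\right)^{N-i}\left(\frac{x-a}{b-a}\right)^i$, $0\le i\le N$, be the Bernstein basis of $\Pi_N$ on $[a,b]$, let $x_i^N=a+\frac{i}{N}(b-a)$, let $T_N$ be the (invertible) matrix $[B_j^N(x_i^N)]_{0\le i,j\le N}$, and define $\lambda_i^N f=\sum_{s=0}^N (T_N^{-1})_{is}\,f(x_s^N)$ for $f\in C[a,b]$. The functionals $\lambda_j^{n_k}$ on $C[c,d]$ are defined in the same way from the Bernstein basis on $[c,d]$ and points $y_j^{n_k}=c+\frac{j}{n_k}(d-c)$. For $F\in C([a,b]\times[c,d])$, $(\lambda_i^{m_r}\times\lambda_j^{n_r})F$ is obtained by applying $\lambda_i^{m_r}$ in the first variable and $\lambda_j^{n_r}$ in the second, i.e. $\sum_{s,t}(T_{m_r}^{-1})_{is}(T_{n_r}^{-1})_{jt}F(x_s^{m_r},y_t^{n_r})$ (with the respective matrices for $[a,b]$ and $[c,d]$). Dual bases: let $\mu_i^{m_k}=\lambda^{m_r}_{\alpha^k_i}$, $0\le i\le m_k$, and $\mu_j^{n_k}=\lambda^{n_r}_{\beta^k_j}$, $0\le j\le n_k$. It is known that $\mu_0^{m_k},\dots,\mu_{m_k}^{m_k}$ are linearly independent on $\Pi_{m_k}$ (and similarly for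 $n_k$); $D_0^{m_k},\dots,D_{m_k}^{m_k}$ denotes the basis of $\Pi_{m_k}$ with $\mu_i^{m_k}D_j^{m_k}=\delta_{ij}$, and $D_0^{n_k},\dots,D_{n_k}^{n_k}$ the basis of $\Pi_{n_k}$ with $\mu_i^{n_k}D_j^{n_k}=\delta_{ij}$. Let $\hat\alpha^k$ be the inverse of $p\mapsto\alpha^k_p$ on $\mathrm{Ran}(\alpha^k)$ (so $\hat\alpha^k(i)=p$ iff $\alpha^k_p=i$) and $\hat\beta^k$ the inverse of $q\mapsto\beta^k_q$ on $\mathrm{Ran}(\beta^k)$. For $(i,j)\in G_{\mathbf m,\mathbf n}$, $$\Phi_{i,j}=\sum_{k=0}^r D^{m_k}_{\hat\alpha^k(i)}\times D^{n_{r-k}}_{\hat\beta^{r-k}(j)}-\sum_{k=0}^{r-1}D^{m_k}_{\hat\alpha^k(i)}\times D^{n_{r-k-1}}_{\hat\beta^{r-k-1}(j)},$$ where $(f\times g)(u,v)=f(u)g(v)$, with the conventions $D^{m_k}_{\hat\alpha^k(i)}:=0$ if $i\notin\mathrm{Ran}(\alpha^k)$ and $D^{n_k}_{\hat\beta^k(j)}:=0$ if $j\notin\mathrm{Ran}(\beta^k)$. *)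

(* Defs.v *)
From HB Require Import structures.
From mathcomp Require Import all_boot all_order all_algebra.
From mathcomp Require Import boolp classical_sets functions reals.

Set Implicit Arguments.
Unset Strict Implicit.
Unset Printing Implicit Defensive.

Import Order.TTheory GRing.Theory Num.Theory.

Local Open Scope ring_scope.

Section LinearAlgebra.
Context {K : nzRingType} {V : lmodType K} {I : finType}.

(* A family is indexed by a finite subset A of I; the values of f outside A
   are irrelevant. *)
Definition lin_span (A : {set I}) (f : I -> V) : set V :=
  [set v | exists c : I -> K, v = \sum_(i in A) c i *: f i]%classic.

Definition lin_indep (A : {set I}) (f : I -> V) : Prop :=
  forall c : I -> K, \sum_(i in A) c i *: f i = 0 ->
    forall i, i \in A -> c i = 0.

Definition is_basis (A : {set I}) (f : I -> V) (S : set V) : Prop :=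
  lin_indep A f /\ lin_span A f = S.

End LinearAlgebra.

(* Polynomials are represented by the functions they induce on R and R * R, so
   that the functionals apply to them directly; R^o is R seen as a vector space
   over itself. *)
Section PolynomialSpaces.
Variable R : realType.

Definition Pi (N : nat) : set (R -> R^o) :=
  [set f | exists2 p : {poly R}, (size p <= N.+1)%N & f = horner p]%classic.

Definition monomial2 (M N : nat) (ij : 'I_M.+1 * 'I_N.+1) : R * R -> R^o :=
  fun z => z.1 ^+ ij.1 * z.2 ^+ ij.2.

Definition Pi2 (M N : nat) : set (R * R -> R^o) :=
  lin_span [set: 'I_M.+1 * 'I_N.+1]%SET (@monomial2 M N).

Definition Smn (r : nat) (m n : nat -> nat) : set (R * R -> R^o) :=
  [set F | exists2 H : 'I_r.+1 -> R * R -> R^o,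
     (forall k : 'I_r.+1, Pi2 (m k) (n (r - k)%N) (H k)) &
     F = \sum_(k < r.+1) H k]%classic.

Definition tensor (f g : R -> R^o) : R * R -> R^o := fun z => f z.1 * g z.2.

End PolynomialSpaces.
Arguments Smn : clear implicits.
Arguments Pi : clear implicits.

(* When m k divides m r, i * m r %/ m k is at most m r, so inord only casts. *)
Definition grid (m : nat -> nat) (r k : nat) (i : 'I_(m k).+1) : 'I_(m r).+1 :=
  inord (i * m r %/ m k).
Arguments grid : clear implicits.

Definition Gmn (r : nat) (m n : nat -> nat) :
    {set 'I_(m r).+1 * 'I_(n r).+1} :=
  (\bigcup_(k < r.+1)
    [set (grid m r k i, grid n r (r - k) j) |
       i : 'I_(m k).+1, j : 'I_(n (r - k)%N).+1])%SET.

Definition bernstein (R : realType) (a b : R) (N i : nat) (x : R) : R :=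
  'C(N, i)%:R * ((b - x) / (b - a)) ^+ (N - i) * ((x - a) / (b - a)) ^+ i.

Definition node (R : realType) (a b : R) (N i : nat) : R :=
  a + i%:R / N%:R * (b - a).

Definition Tmx (R : realType) (a b : R) (N : nat) : 'M[R]_N.+1 :=
  \matrix_(i, j) bernstein a b N j (node a b N i).

(* The functionals only sample their argument at the nodes, hence make sense
   for arbitrary functions and not just for continuous ones. *)
Definition lambda (R : realType) (a b : R) (N : nat) (i : 'I_N.+1)
    (f : R -> R^o) : R :=
  \sum_(s < N.+1) invmx (Tmx a b N) i s * f (node a b N s).
Arguments lambda {R} a b N i f.

Definition lambda2 (R : realType) (a b c d : R) (M N : nat)
    (i : 'I_M.+1) (j : 'I_N.+1) (F : R * R -> R^o) : R :=
  \sum_(s < M.+1) \sum_(t < N.+1)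
    invmx (Tmx a b M) i s * invmx (Tmx c d N) j t *
      F (node a b M s, node c d N t).
Arguments lambda2 {R} a b c d M N i j F.

Definition mu (R : realType) (a b : R) (m : nat -> nat) (r k : nat)
    (i : 'I_(m k).+1) : (R -> R^o) -> R :=
  lambda a b (m r) (grid m r k i).
Arguments mu {R} a b m r k i.

(* Definite description: D is the dual basis as soon as one exists (the default
   value 0 does not satisfy the defining property). *)
Definition D (R : realType) (a b : R) (m : nat -> nat) (r k : nat) :
    'I_(m k).+1 -> R -> R^o :=
  xget (fun _ _ => 0) [set E : 'I_(m k).+1 -> R -> R^o |
    is_basis [set: 'I_(m k).+1]%SET E (Pi R (m k)) /\
    (forall i j, mu a b m r k i (E j) = (i == j)%:R)]%classic.
Arguments D {R} a b m r k.

(* D^{m_k} at the index p with grid m r k p = i, and 0 when i is not in the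
   range of the grid. *)
Definition Dhat (R : realType) (a b : R) (m : nat -> nat) (r k : nat)
    (i : 'I_(m r).+1) : R -> R^o :=
  if [pick p : 'I_(m k).+1 | grid m r k p == i] is Some p
  then D a b m r k p else 0.
Arguments Dhat {R} a b m r k i.

Definition Phi (R : realType) (a b c d : R) (r : nat) (m n : nat -> nat)
    (ij : 'I_(m r).+1 * 'I_(n r).+1) : R * R -> R^o :=
  \sum_(k < r.+1)
     tensor (Dhat a b m r k ij.1) (Dhat c d n r (r - k) ij.2) -
  \sum_(k < r)
     tensor (Dhat a b m r k ij.1) (Dhat c d n r (r - k - 1) ij.2).
Arguments Phi {R} a b c d r m n ij.

(* Main.v *)
Require Import Defs.
From mathcomp Require Import all_boot all_order all_algebra ring.
From mathcomp Require Import boolp classical_sets functions reals.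
Import Order.TTheory GRing.Theory Num.Theory.
Local Open Scope ring_scope.

(** The functional [lambda a b N i] reads off the [i]-th Bernstein coefficient
    of a polynomial of degree at most [N].  With [t = (x - a) / (b - a)], the
    coefficients of [t ^ j] are ['C(i, j) / 'C(N, j)] ([lambda_monomial]), and
    these are polynomial of degree [j] in the index [i].  So the Bernstein
    coefficients of a polynomial of degree at most [m <= N], taken at any
    [m + 1] distinct indices, determine it: a polynomial in [i] of degree at
    most [m] with [m + 1] roots is zero ([binomial_unisolvent]).  Hence the dual
    bases [D] exist ([lambda_dual_basis]).

    In one variable, [P_k f = \sum_i lambda_i f *: Dhat_i^k] is then a projector
    onto the polynomials of degree at most [m k] ([Dhat_reproduce]), and
    [lambda_i Dhat_p^k] is the Kronecker delta as soon as [i] lies on the [k]-th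
    grid ([lambda_Dhat]).  Since [m k] divides [m k.+1], the spaces and the grids
    both increase with [k].

    The function [Phi] is a Boolean sum of tensor products.  Both parts of the
    theorem come from one cancellation ([boolean_sum]): if [x k = X] for
    [k >= l], and [y (r - k) = Y] for [k <= l], then
    [\sum_(k <= r) x_k y_(r-k) - \sum_(k < r) x_k y_(r-k-1) = X Y].
    For duality, [x k] and [y k] are the values of [lambda_i] and [lambda_j] on
    the dual functions, for a point [(i, j)] of the [l]-th tensor grid
    ([lambda2_Phi]).  For the span, they are the values of the projections of
    [f] and [g], for [f] and [g] of degree at most [m l] and [n (r - l)]; this
    writes [tensor f g] as the combination of the [Phi_ij] with coefficients
    [lambda_i f * lambda_j g] ([tensor_reproduce]).  Linear independence follows
    from duality. *)

Set Implicit Arguments.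
Unset Strict Implicit.
Unset Printing Implicit Defensive.

(** * Bernstein coefficients of powers *)

(** The [j]-th power of the affine coordinate sending [a] to 0 and [b] to 1. *)
Definition unit_monomial (R : realType) (a b : R) (j : nat) : R -> R^o :=
  fun x => ((x - a) / (b - a)) ^+ j.

Lemma bin_mul_swap (N i j : nat) : (j <= i <= N)%N ->
  ('C(i, j) * 'C(N, i) = 'C(N, j) * 'C(N - j, i - j))%N.
Proof.
case/andP=> ji iN.
have jN := leq_trans ji iN.
have e : (N - j - (i - j) = N - i)%N by rewrite subnBA // subnK.
have := bin_fact (leq_sub2r j iN); rewrite e => h1.
apply/eqP; rewrite -(eqn_pmul2r (fact_gt0 j)) -(eqn_pmul2r (fact_gt0 (i - j))).
rewrite -(eqn_pmul2r (fact_gt0 (N - i))); apply/eqP.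
transitivity N`!.
  by rewrite -(bin_fact iN) -[in RHS](bin_fact ji); ring.
by rewrite -(bin_fact jN) -h1; ring.
Qed.

Lemma bernstein_monomial (R : realType) (a b : R) (N j : nat) (x : R) :
  a < b -> (j <= N)%N ->
  \sum_(i < N.+1) 'C(i, j)%:R / 'C(N, j)%:R * bernstein a b N i x =
    unit_monomial a b j x.
Proof.
move=> ab jN; rewrite /unit_monomial; set t := (x - a) / (b - a).
have ba0 : b - a != 0 by rewrite subr_eq0 gt_eqF.
have et : (b - x) / (b - a) = 1 - t.
  by rewrite /t -[1](divff ba0) -mulrBl; congr (_ / _); ring.
have C0 : 'C(N, j)%:R != 0 :> R by rewrite pnatr_eq0 -lt0n bin_gt0.
rewrite /bernstein et -/t.
transitivity (\sum_(j <= i < N.+1)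
    t ^+ j * ((1 - t) ^+ (N - i) * t ^+ (i - j) *+ 'C(N - j, i - j))).
  rewrite -(big_mkord xpredT (fun i =>
     'C(i, j)%:R / 'C(N, j)%:R * ('C(N, i)%:R * (1 - t) ^+ (N - i) * t ^+ i))).
  rewrite (@big_cat_nat _ _ _ j) //=; last by rewrite leqW.
  rewrite big_nat big1 ?add0r => [|i /andP[_ ij]]; last first.
    by rewrite bin_small // mul0r mul0r.
  apply: eq_big_nat => i /andP[ji]; rewrite ltnS => iN.
  have := congr1 (fun k => k%:R : R) (@bin_mul_swap N i j _).
  rewrite ji iN => /(_ isT); rewrite !natrM => e.
  (* Both sides are compared after clearing the denominator 'C(N, j). *)
  rewrite -mulr_natr -[in t ^+ i](subnKC ji) exprD.
  apply: (mulfI C0); transitivity ('C(i, j)%:R * 'C(N, i)%:R *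
    ((1 - t) ^+ (N - i) * t ^+ j * t ^+ (i - j))); last by rewrite e; ring.
  by field.
rewrite -big_distrr /= -[X in index_iota X]add0n big_addn subSn // big_mkord.
rewrite (eq_bigr (fun i : 'I_(N - j).+1 =>
   (1 - t) ^+ ((N - j) - i) * t ^+ i *+ 'C(N - j, i))); last first.
  by move=> i _; rewrite addnK subnDA subnAC.
by rewrite -exprDn subrK expr1n mulr1.
Qed.

Lemma node_coord (R : realType) (a b : R) (N i : nat) : a < b ->
  (node a b N i - a) / (b - a) = i%:R / N%:R.
Proof.
move=> ab; have ba0 : b - a != 0 by rewrite subr_eq0 gt_eqF.
by rewrite /node addrAC subrr add0r mulfK.
Qed.

(** Column [j] holds the Bernstein coefficients of [unit_monomial a b j]. *)
Definition bin_mx (R : realType) (N : nat) : 'M[R]_N.+1 :=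
  \matrix_(i, j) ('C(i, j)%:R / 'C(N, j)%:R).

Lemma Tmx_bin_mx (R : realType) (a b : R) (N : nat) : a < b ->
  Tmx a b N *m bin_mx R N =
    (Vandermonde N.+1 (\row_(s < N.+1) (s%:R / N%:R)))^T.
Proof.
move=> ab; apply/matrixP => s j; rewrite !mxE -(@node_coord _ a b N) //.
rewrite -[RHS]/(unit_monomial a b j (node a b N s)).
rewrite -(bernstein_monomial (N := N)) //; last by rewrite -ltnS.
by apply: eq_bigr => i _; rewrite !mxE mulrC.
Qed.

(** The equally spaced nodes are distinct when [N] is positive, so the
    Vandermonde matrix, hence its factor [Tmx a b N], is invertible. *)
Lemma Tmx_unit (R : realType) (a b : R) (N : nat) : a < b -> (0 < N)%N ->
  Tmx a b N \in unitmx.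
Proof.
move=> ab N0.
suff: Tmx a b N *m bin_mx R N \in unitmx by rewrite unitmx_mul => /andP[].
rewrite Tmx_bin_mx // unitmx_tr unitmxE det_Vandermonde unitfE.
apply/prodf_neq0 => i _; apply/prodf_neq0 => j ij; rewrite !mxE.
by rewrite -mulrBl mulf_neq0 ?invr_eq0 ?pnatr_eq0 ?subr_eq0 ?eqr_nat -?lt0n ?gtn_eqF.
Qed.

Lemma lambda_monomial (R : realType) (a b : R) (N j : nat) (i : 'I_N.+1) :
  a < b -> (0 < N)%N -> (j <= N)%N ->
  lambda a b N i (unit_monomial a b j) =
    'C(i, j)%:R / 'C(N, j)%:R.
Proof.
move=> ab N0 jN; pose j' : 'I_N.+1 := Ordinal (jN : (j < N.+1)%N).
have /(congr1 (fun M : 'M[R]_N.+1 => M i j')) := mulKmx (Tmx_unit ab N0) (bin_mx R N).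
rewrite Tmx_bin_mx // !mxE /= => <-.
by apply: eq_bigr => s _; rewrite !mxE /unit_monomial node_coord.
Qed.

(** * Unisolvence at distinct indices *)

(** The polynomial ['X ('X - 1) ... ('X - j + 1) / j!], which interpolates the
    binomial coefficients ['C(n, j)] as a function of [n]. *)
Definition binomial_poly (R : realType) (j : nat) : {poly R} :=
  (j`!%:R)^-1 *: \prod_(i < j) ('X - i%:R%:P).

Lemma size_binomial_poly (R : realType) (j : nat) :
  (size (binomial_poly R j) <= j.+1)%N.
Proof.
apply: leq_trans (size_scale_leq _ _) _.
by rewrite size_prod_XsubC -[index_enum _]enumT size_enum_ord.
Qed.

Lemma horner_binomial_poly (R : realType) (j n : nat) :
  (binomial_poly R j).[n%:R] = 'C(n, j)%:R.
Proof.
rewrite hornerZ horner_prod.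
have f0 : j`!%:R != 0 :> R by rewrite pnatr_eq0 -lt0n fact_gt0.
apply: (mulfI f0); rewrite mulrA divff // mul1r -natrM mulnC bin_ffact.
have [jn|nj] := leqP j n.
  rewrite ffact_prod natr_prod; apply: eq_bigr => i _.
  by rewrite !hornerE natrB // ltnW // (leq_trans (ltn_ord i)).
(* For n < j the factor of index n vanishes. *)
rewrite ffact_small // (bigD1 (Ordinal nj)) //= !hornerE subrr.
by rewrite mul0r.
Qed.

(** The binomial polynomials of index at most [m] are linearly independent on
    any [m + 1] distinct natural numbers. *)
Lemma binomial_unisolvent (R : realType) (m N : nat) (g : 'I_m.+1 -> 'I_N.+1)
    (c : 'I_m.+1 -> R) : injective g ->
  (forall i, \sum_(j < m.+1) c j * 'C(g i, j)%:R = 0) -> forall j, c j = 0.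
Proof.
move=> ginj h; pose q := \sum_(j < m.+1) c j *: binomial_poly R j.
have qE n : q.[n%:R] = \sum_(j < m.+1) c j * 'C(n, j)%:R.
  rewrite horner_sum; apply: eq_bigr => j _.
  by rewrite hornerZ horner_binomial_poly.
have q0 : q = 0.
  pose rs := [seq (g i : nat)%:R : R | i <- enum 'I_m.+1].
  apply/eqP; apply: contraT => /(@max_poly_roots _ _ rs).
  have -> : all (root q) rs.
    by apply/allP => _ /mapP[i _ ->]; rewrite rootE qE h.
  have -> : uniq rs.
    rewrite map_inj_uniq ?enum_uniq // => i j /eqP.
    by rewrite eqr_nat => /eqP/val_inj/ginj.
  rewrite size_map size_enum_ord => /(_ isT isT) lt.
  suff: (size q <= m.+1)%N by rewrite leqNgt lt.
  apply: leq_trans (size_sum _ _ _) _; apply/bigmax_leqP => j _.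
  apply: leq_trans (size_scale_leq _ _) _.
  exact: leq_trans (size_binomial_poly _ _) (ltn_ord _).
(* As q vanishes at 0, ..., m, the lower triangular system with entries
   'C(n, j) and unit diagonal forces each coefficient to be 0. *)
move=> j; have [n] := ubnP (j : nat); elim: n j => // n IH j; rewrite ltnS => jn.
have := qE j; rewrite q0 horner0 (bigD1 j) //= binn mulr1 big1 ?addr0 //.
move=> i; rewrite neq_ltn => /orP[ij|ji].
  by rewrite IH ?mul0r // (leq_trans ij).
by rewrite bin_small // mulr0.
Qed.

(** * Dual bases of polynomial spaces *)

Lemma lambda_sum (R : realType) (a b : R) (N : nat) (i : 'I_N.+1) (I : finType)
    (P : pred I) (c : I -> R) (f : I -> R -> R^o) :
  lambda a b N i (\sum_(k | P k) c k *: f k) =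
    \sum_(k | P k) c k * lambda a b N i (f k).
Proof.
rewrite /lambda fct_sumE.
under eq_bigr do rewrite mulr_sumr.
rewrite exchange_big; apply: eq_bigr => k _; rewrite mulr_sumr.
by apply: eq_bigr => s _; rewrite mulrCA.
Qed.

Lemma Pi_sum (R : realType) (N : nat) (I : finType) (P : pred I) (c : I -> R)
    (f : I -> R -> R^o) :
  (forall k, P k -> Pi R N (f k)) -> Pi R N (\sum_(k | P k) c k *: f k).
Proof.
move=> h; have h' k : exists q : {poly R},
    P k -> (size q <= N.+1)%N /\ f k = horner q.
  have [/h[q sq fq]|_] := boolP (P k); last by exists 0.
  by exists q.
have [q qP] := choice h'.
exists (\sum_(k | P k) c k *: q k).
  apply: leq_trans (size_sum _ _ _) _; apply/bigmax_leqP => k /qP[sq _].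
  exact: leq_trans (size_scale_leq _ _) sq.
apply/funext => x; rewrite fct_sumE horner_sum; apply: eq_bigr => k /qP[_ fq].
by rewrite hornerZ -fq.
Qed.

Lemma Pi_le (R : realType) (M N : nat) (f : R -> R^o) :
  (M <= N)%N -> Pi R M f -> Pi R N f.
Proof. by move=> MN [p sp ->]; exists p => //; apply: leq_trans sp _. Qed.

Lemma Pi_unit_monomial (R : realType) (a b : R) (N j : nat) : (j <= N)%N ->
  Pi R N (unit_monomial a b j).
Proof.
move=> jN; exists (((b - a)^-1 *: ('X - a%:P)) ^+ j).
  apply: leq_trans (size_poly_exp_leq _ _) _; rewrite ltnS.
  have : ((size ((b - a)^-1 *: ('X - a%:P))).-1 <= 1)%N.
    have := size_scale_leq (b - a)^-1 ('X - a%:P); rewrite size_XsubC.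
    by case: size.
  by move=> h; apply: leq_trans jN; rewrite -[leqRHS]mul1n leq_mul2r h orbT.
by apply/funext => x; rewrite !hornerE /unit_monomial mulrC.
Qed.

Lemma Pi_unit_monomialE (R : realType) (a b : R) (N : nat) (f : R -> R^o) :
  a < b -> Pi R N f ->
  exists c : 'I_N.+1 -> R, f = \sum_(j < N.+1) c j *: unit_monomial a b j.
Proof.
move=> ab [p sp ->]; have ba0 : b - a != 0 by rewrite subr_eq0 gt_eqF.
pose q := p \Po ((b - a) *: 'X + a%:P).
have sq : (size q <= N.+1)%N.
  rewrite size_comp_poly2 //.
  by rewrite size_polyDl ?size_scale ?size_polyX // (leq_ltn_trans (size_polyC_leq1 _)).
exists (fun j => q`_j); apply/funext => x; rewrite fct_sumE.
transitivity q.[(x - a) / (b - a)].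
  rewrite /q horner_comp; congr (p.[_]).
  by rewrite hornerD hornerZ hornerX hornerC mulrC divfK // subrK.
by rewrite (horner_coef_wide _ sq).
Qed.

(** Any [m + 1] distinct functionals among the [lambda a b N i] have a dual basis
    in the polynomials of degree at most [m].  Their matrix [A] on the powers of
    the affine coordinate is invertible by unisolvence, and the columns of its
    inverse give the dual basis. *)
Lemma lambda_dual_basis (R : realType) (a b : R) (m N : nat)
    (g : 'I_m.+1 -> 'I_N.+1) : a < b -> (0 < N)%N -> (m <= N)%N -> injective g ->
  exists E : 'I_m.+1 -> R -> R^o, is_basis [set: 'I_m.+1]%SET E (Pi R m) /\
    forall i j, lambda a b N (g i) (E j) = (i == j)%:R.
Proof.
move=> ab N0 mN ginj.
pose A : 'M[R]_m.+1 := \matrix_(i, l) ('C(g i, l)%:R / 'C(N, l)%:R).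
have lE (c : 'I_m.+1 -> R) i :
    lambda a b N (g i) (\sum_(l < m.+1) c l *: unit_monomial a b l) =
    \sum_(l < m.+1) A i l * c l.
  rewrite lambda_sum /=; apply: eq_bigr => l _.
  by rewrite lambda_monomial // ?mxE 1?mulrC // -ltnS (leq_trans (ltn_ord l)).
have Au : A \in unitmx.
  rewrite -unitmx_tr -row_free_unit; apply: inj_row_free => v vA.
  apply/rowP => l; rewrite mxE; have C0 : 'C(N, l)%:R != 0 :> R.
    by rewrite pnatr_eq0 -lt0n bin_gt0 -ltnS (leq_trans (ltn_ord l)).
  have := @binomial_unisolvent R m N g (fun l => v 0 l / 'C(N, l)%:R) ginj.
  move=> /(_ _ l)/eqP; rewrite mulf_eq0 invr_eq0 (negPf C0) orbF => h.
  apply/eqP/h => i; transitivity ((v *m A^T) 0 i); last by rewrite vA mxE.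
  by rewrite mxE; apply: eq_bigr => k _; rewrite !mxE mulrAC mulrA.
pose E j : R -> R^o := \sum_(l < m.+1) invmx A l j *: unit_monomial a b l.
have dual i j : lambda a b N (g i) (E j) = (i == j)%:R.
  by rewrite lE; have /matrixP/(_ i j) := mulmxV Au; rewrite !mxE.
exists E; split=> //; split.
  move=> c c0 i _; have := congr1 (lambda a b N (g i)) c0.
  rewrite lambda_sum (bigD1 i) ?inE //= dual eqxx mulr1 big1 ?addr0 => [->|j /andP[_ ji]].
    by rewrite /lambda big1 // => s _; rewrite mulr0.
  by rewrite dual eq_sym (negPf ji) mulr0.
apply/seteqP; split => f.
  move=> [c ->]; apply: Pi_sum => j _; apply: Pi_sum => l _.
  by apply: Pi_unit_monomial; rewrite -ltnS.
move=> /(Pi_unit_monomialE ab)[c fE].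
(* The coordinates of f on the dual basis are its Bernstein
   coefficients A c at the indices g. *)
exists (fun j => \sum_(l < m.+1) A j l * c l).
rewrite fE; apply/funext => x; rewrite !fct_sumE.
transitivity (\sum_(j in [set: 'I_m.+1]%SET) \sum_(k < m.+1)
   (invmx A k j * \sum_(l < m.+1) A j l * c l) * unit_monomial a b k x); last first.
  apply: eq_bigr => j _; rewrite /E fct_sumE -[RHS]/(_ * _) mulr_sumr.
  by apply: eq_bigr => k _; rewrite mulrAC mulrC.
rewrite exchange_big; apply: eq_bigr => k _ /=; rewrite -mulr_suml; congr (_ * _).
have /matrixP/(_ k 0) := mulKmx Au (\col_l c l); rewrite !mxE => <-.
apply: eq_big => j; rewrite ?inE // mxE => _; congr (_ * _).
by apply: eq_bigr => l _; rewrite [(\col__ _) _ _]mxE.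
Qed.

(** * Nested grids *)

Section Grid.
Variables (m : nat -> nat) (r : nat).
Hypothesis m_gt0 : forall k : nat, (k <= r)%N -> (0 < m k)%N.
Hypothesis m_dvd : forall k : nat, (k < r)%N -> (m k %| m k.+1)%N.

Lemma degree_dvd (k l : nat) : (k <= l <= r)%N -> (m k %| m l)%N.
Proof.
case/andP; elim: l => [|l IH]; first by rewrite leqn0 => /eqP->.
rewrite leq_eqVlt => /predU1P[->//|]; rewrite ltnS => kl lr.
exact: dvdn_trans (IH kl (ltnW lr)) (m_dvd lr).
Qed.

Lemma degree_le (k l : nat) : (k <= l <= r)%N -> (m k <= m l)%N.
Proof.
by move=> klr; apply: dvdn_leq (degree_dvd klr); case/andP: klr => _ /m_gt0.
Qed.

Lemma gridE (k : nat) (i : 'I_(m k).+1) : (k <= r)%N ->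
  grid m r k i = (i * (m r %/ m k))%N :> nat.
Proof.
move=> kr; have d : (m k %| m r)%N by rewrite degree_dvd ?kr /=.
rewrite /grid -muln_divA // inordK // ltnS.
by rewrite -[leqRHS](divnK d) mulnC leq_mul2l -ltnS ltn_ord orbT.
Qed.

Lemma grid_inj (k : nat) : (k <= r)%N -> injective (grid m r k).
Proof.
move=> kr i j /(congr1 (@nat_of_ord _)); rewrite !gridE // => /eqP.
rewrite eqn_pmul2r => [/eqP/val_inj//|].
by rewrite divn_gt0 ?m_gt0 // degree_le // kr /=.
Qed.

Lemma grid_refine (k l : nat) (i : 'I_(m k).+1) : (k <= l <= r)%N ->
  exists i' : 'I_(m l).+1, grid m r l i' = grid m r k i.
Proof.
move=> klr; have /andP[kl lr] := klr; have kr := leq_trans kl lr.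
have d := degree_dvd klr.
have d' : (m l %| m r)%N by rewrite degree_dvd ?lr /=.
have h : (i * (m l %/ m k) < (m l).+1)%N.
  by rewrite ltnS -[leqRHS](divnK d) mulnC leq_mul2l -ltnS ltn_ord orbT.
exists (Ordinal h); apply/val_inj; rewrite /= !gridE //= -mulnA; congr (_ * _)%N.
by rewrite mulnC muln_divA // divnK.
Qed.

End Grid.

(** * Dual functions in one variable *)

Section DualBasis.
Variables (R : realType) (a b : R) (m : nat -> nat) (r : nat).
Hypothesis ab : a < b.
Hypothesis m_gt0 : forall k : nat, (k <= r)%N -> (0 < m k)%N.
Hypothesis m_dvd : forall k : nat, (k < r)%N -> (m k %| m k.+1)%N.
Variable k : nat.
Hypothesis kr : (k <= r)%N.

Lemma D_dual_basis :
  is_basis [set: 'I_(m k).+1]%SET (D a b m r k) (Pi R (m k)) /\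
  forall i j, lambda a b (m r) (grid m r k i) (D a b m r k j) = (i == j)%:R.
Proof.
have mk : (m k <= m r)%N by apply: (degree_le m_gt0 m_dvd); rewrite kr /=.
have := lambda_dual_basis ab (m_gt0 (leqnn r)) mk (grid_inj m_gt0 m_dvd kr).
by move=> /(xgetPex (fun _ _ => 0)).
Qed.

Lemma Dhat_grid (p : 'I_(m k).+1) :
  Dhat a b m r k (grid m r k p) = D a b m r k p.
Proof.
rewrite /Dhat; case: pickP => [q /eqP/(grid_inj m_gt0 m_dvd kr) ->//|].
by move=> /(_ p); rewrite eqxx.
Qed.

Lemma Dhat_notin (i : 'I_(m r).+1) :
  (forall p, grid m r k p != i) -> Dhat a b m r k i = 0.
Proof. by move=> h; rewrite /Dhat; case: pickP => // p; rewrite (negPf (h p)). Qed.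

Lemma Dhat_Pi (i : 'I_(m r).+1) : Pi R (m k) (Dhat a b m r k i).
Proof.
have [[_ <-] _] := D_dual_basis.
rewrite /Dhat; case: pickP => [p _|_].
  exists (fun j => (j == p)%:R); rewrite (bigD1 p) ?inE //= eqxx scale1r.
  by rewrite big1 ?addr0 // => j /andP[_ /negPf->]; rewrite scale0r.
by exists (fun _ => 0); rewrite big1 // => j _; rewrite scale0r.
Qed.

(** When [i] is off the [k]-th grid, the dual function is 0 and the two indices
    differ, so the formula holds for every [i]. *)
Lemma lambda_Dhat (p : 'I_(m k).+1) (i : 'I_(m r).+1) :
  lambda a b (m r) (grid m r k p) (Dhat a b m r k i) = (grid m r k p == i)%:R.
Proof.
have [/existsP[q /eqP <-]|/existsPn h] := boolP [exists q, grid m r k q == i].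
  rewrite Dhat_grid (proj2 D_dual_basis).
  by rewrite (inj_eq (grid_inj m_gt0 m_dvd kr)).
rewrite Dhat_notin // (negPf (h p)).
by rewrite /lambda big1 // => s _; rewrite mulr0.
Qed.

(** The sum may run over all indices because [Dhat] vanishes off the grid. *)
Lemma Dhat_reproduce (f : R -> R^o) : Pi R (m k) f ->
  f = \sum_i lambda a b (m r) i f *: Dhat a b m r k i.
Proof.
have [[_ Dspan] Ddual] := D_dual_basis; rewrite -{1}Dspan => -[c fE].
have lf p : lambda a b (m r) (grid m r k p) f = c p.
  rewrite {1}fE lambda_sum (bigD1 p) ?inE //= Ddual eqxx mulr1.
  rewrite big1 ?addr0 // => q /andP[_ qp]; rewrite Ddual.
  by rewrite eq_sym (negPf qp) mulr0.
rewrite (bigID (mem (grid m r k @: [set: 'I_(m k).+1]))) /=.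
rewrite [X in _ + X]big1 ?addr0 => [|i /imsetP h]; last first.
  rewrite Dhat_notin ?scaler0 // => p; apply/eqP => pi; case: h; exists p => //.
  by rewrite inE.
rewrite big_imset /=; last by move=> p q _ _; apply: (grid_inj m_gt0 m_dvd).
by rewrite {1}fE; apply: eq_bigr => p _; rewrite lf Dhat_grid.
Qed.

End DualBasis.

(** * The Boolean sum cancellation *)

(** Pairing the terms of index [k], the factor [x k] may be replaced by [X] in
    [x k * (y (r - k) - y (r - k - 1))]: either [l <= k], or both values of [y]
    are [Y].  The sum then telescopes. *)
Lemma boolean_sum (K : pzRingType) (r l : nat) (x y : nat -> K) (X Y : K) :
  (l <= r)%N -> (forall k, (l <= k <= r)%N -> x k = X) ->
  (forall k, (k <= l)%N -> y (r - k)%N = Y) ->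
  \sum_(k < r.+1) x k * y (r - k)%N - \sum_(k < r) x k * y (r - k - 1)%N = X * Y.
Proof.
move=> lr hx hy.
rewrite big_ord_recr /= subnn (hx r) ?lr ?leqnn // addrAC -sumrB.
rewrite (eq_bigr (fun k : 'I_r => - (X * (y (r - k.+1)%N - y (r - k)%N)))).
  rewrite sumrN -mulr_sumr -(big_mkord xpredT (fun k => y (r - k.+1)%N - y (r - k)%N)).
  rewrite telescope_sumr // subnn subn0 -mulrN opprB -mulrDr subrK.
  by rewrite -(hy 0%N) // subn0.
move=> k _; rewrite -subnDA addn1 -mulrBr -mulrN opprB.
have [lk|kl] := leqP l k; first by rewrite hx // lk ltnW.
by rewrite (hy k.+1) // (hy k) 1?ltnW // subrr !mulr0.
Qed.

(** * Tensor products *)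

Lemma lambda2_tensor (R : realType) (a b c d : R) (M N : nat) (i : 'I_M.+1)
    (j : 'I_N.+1) (f g : R -> R^o) :
  lambda2 a b c d M N i j (tensor f g) = lambda a b M i f * lambda c d N j g.
Proof.
rewrite /lambda2 /lambda big_distrlr; apply: eq_bigr => s _.
by apply: eq_bigr => t _; rewrite /tensor mulrACA.
Qed.

Lemma lambda2_sum (R : realType) (a b c d : R) (M N : nat) (i : 'I_M.+1)
    (j : 'I_N.+1) (I : finType) (P : pred I) (e : I -> R)
    (F : I -> R * R -> R^o) :
  lambda2 a b c d M N i j (\sum_(k | P k) e k *: F k) =
    \sum_(k | P k) e k * lambda2 a b c d M N i j (F k).
Proof.
rewrite /lambda2 fct_sumE.
under eq_bigr do (under eq_bigr do rewrite mulr_sumr; rewrite exchange_big).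
rewrite exchange_big; apply: eq_bigr => k _; rewrite mulr_sumr.
apply: eq_bigr => s _; rewrite mulr_sumr.
by apply: eq_bigr => t _; rewrite mulrCA.
Qed.

Lemma lambda2B (R : realType) (a b c d : R) (M N : nat) (i : 'I_M.+1)
    (j : 'I_N.+1) (F G : R * R -> R^o) :
  lambda2 a b c d M N i j (F - G) =
    lambda2 a b c d M N i j F - lambda2 a b c d M N i j G.
Proof.
rewrite /lambda2 -sumrB; apply: eq_bigr => s _; rewrite -sumrB.
by apply: eq_bigr => t _; rewrite -mulrBr.
Qed.

Lemma lin_span_sum (K : nzRingType) (V : lmodType K) (I J : finType)
    (A : {set I}) (f : I -> V) (P : pred J) (e : J -> K) (v : J -> V) :
  (forall k, P k -> lin_span A f (v k)) ->
  lin_span A f (\sum_(k | P k) e k *: v k).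
Proof.
move=> h; have h' k : exists c : I -> K, P k -> v k = \sum_(i in A) c i *: f i.
  by have [/h[c ->]|_] := boolP (P k); [exists c|exists (fun _ => 0)].
have [c cP] := choice h'; exists (fun i => \sum_(k | P k) e k * c k i).
under [RHS]eq_bigr do rewrite scaler_suml.
rewrite exchange_big; apply: eq_bigr => k /cP->; rewrite scaler_sumr.
by apply: eq_bigr => i _; rewrite scalerA.
Qed.

Lemma Pi2_tensor (R : realType) (M N : nat) (f g : R -> R^o) :
  Pi R M f -> Pi R N g -> Pi2 M N (tensor f g).
Proof.
move=> [p sp ->] [q sq ->].
exists (fun ij : 'I_M.+1 * 'I_N.+1 => p`_ij.1 * q`_ij.2); apply/funext => z.
rewrite fct_sumE /tensor (horner_coef_wide _ sp) (horner_coef_wide _ sq).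
rewrite big_distrlr pair_big /=; apply: eq_big => ij; first by rewrite inE.
by rewrite mulrACA.
Qed.

Lemma Pi_power (R : realType) (N j : nat) : (j <= N)%N ->
  Pi R N (fun x => x ^+ j).
Proof.
move=> jN; exists 'X^j; first by rewrite size_polyXn.
by apply/funext => x; rewrite hornerXn.
Qed.

Lemma Smn_sum (R : realType) (r : nat) (m n : nat -> nat) (I : finType)
    (P : pred I) (e : I -> R) (F : I -> R * R -> R^o) :
  (forall i, P i -> Smn R r m n (F i)) ->
  Smn R r m n (\sum_(i | P i) e i *: F i).
Proof.
move=> h; have h' i : exists H : 'I_r.+1 -> R * R -> R^o, P i ->
    (forall k : 'I_r.+1, Pi2 (m k) (n (r - k)%N) (H k)) /\
    F i = \sum_(k < r.+1) H k.
  have [/h[H H1 H2]|_] := boolP (P i); last by exists (fun _ => 0).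
  by exists H => _; split.
have [H HP] := choice h'; exists (fun k => \sum_(i | P i) e i *: H i k).
  by move=> k; apply: lin_span_sum => i /HP[Hi _]; apply: Hi.
rewrite exchange_big; apply: eq_bigr => i /HP[_ ->].
by rewrite scaler_sumr.
Qed.

(** * The functions Phi *)

Section Bivariate.
Variables (R : realType) (r : nat) (a b c d : R) (m n : nat -> nat).
Hypotheses (ab : a < b) (cd : c < d).
Hypothesis m_gt0 : forall k : nat, (k <= r)%N -> (0 < m k)%N.
Hypothesis n_gt0 : forall k : nat, (k <= r)%N -> (0 < n k)%N.
Hypothesis m_dvd : forall k : nat, (k < r)%N -> (m k %| m k.+1)%N.
Hypothesis n_dvd : forall k : nat, (k < r)%N -> (n k %| n k.+1)%N.

Local Notation Phi := (Phi a b c d r m n).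
Local Notation lambda2 := (lambda2 a b c d (m r) (n r)).

Lemma GmnP (ij : 'I_(m r).+1 * 'I_(n r).+1) :
  reflect (exists l, [/\ (l <= r)%N, exists p, grid m r l p = ij.1
                      & exists q, grid n r (r - l) q = ij.2])
          (ij \in Gmn r m n).
Proof.
apply: (iffP bigcupP) => [[l _ /imset2P[p q _ _ ->]]|[l [lr [p hp] [q hq]]]].
  by exists l; split; [rewrite -ltnS|exists p|exists q].
exists (Ordinal (lr : (l < r.+1)%N)) => //; apply/imset2P.
by exists p q; rewrite // hp hq; case: ij {hp hq}.
Qed.

Lemma PhiE (ij : 'I_(m r).+1 * 'I_(n r).+1) (z : R * R) :
  Phi ij z =
    \sum_(k < r.+1) Dhat a b m r k ij.1 z.1 * Dhat c d n r (r - k) ij.2 z.2 -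
    \sum_(k < r) Dhat a b m r k ij.1 z.1 * Dhat c d n r (r - k - 1) ij.2 z.2.
Proof. by rewrite /Defs.Phi !fct_sumE. Qed.

(** A term of either sum is nonzero only on a tensor grid contained in
    [Gmn r m n]; for the second sum this uses that the grid of index
    [r - k - 1] is contained in the one of index [r - k]. *)
Lemma Phi_notin (ij : 'I_(m r).+1 * 'I_(n r).+1) : ij \notin Gmn r m n ->
  Phi ij = 0.
Proof.
move=> /GmnP ijG; apply/funext => z; rewrite PhiE.
have tensor0 k l : (k <= r)%N -> (l <= r - k)%N ->
    Dhat a b m r k ij.1 z.1 * Dhat c d n r l ij.2 z.2 = 0.
  move=> kr lk.
  have [/existsP[p /eqP hp]|/existsPn h] := boolP [exists p, grid m r k p == ij.1];
    last by rewrite Dhat_notin // mul0r.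
  have [/existsP[q /eqP hq]|/existsPn h] := boolP [exists q, grid n r l q == ij.2];
    last by rewrite (Dhat_notin c d h) mulr0.
  case: ijG; exists k; split=> //; first by exists p.
  have h : (l <= r - k <= r)%N by rewrite lk leq_subr.
  by have [q' hq'] := grid_refine n_dvd q h; exists q'; rewrite hq'.
rewrite !big1 ?subrr // => k _; apply: tensor0 => //; first exact: ltnW.
  by rewrite leq_subr.
by rewrite -ltnS.
Qed.

Lemma lambda2_Phi (ij pq : 'I_(m r).+1 * 'I_(n r).+1) : ij \in Gmn r m n ->
  lambda2 ij.1 ij.2 (Phi pq) = (ij.1 == pq.1)%:R * (ij.2 == pq.2)%:R.
Proof.
move=> /GmnP[l [lr [p hp] [q hq]]].
pose x k := lambda a b (m r) ij.1 (Dhat a b m r k pq.1).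
pose y k := lambda c d (n r) ij.2 (Dhat c d n r k pq.2).
have hx k : (l <= k <= r)%N -> x k = (ij.1 == pq.1)%:R.
  move=> lkr; have [p' hp'] := grid_refine m_dvd p lkr.
  by rewrite /x -hp -hp' lambda_Dhat //; case/andP: lkr.
have hy k : (k <= l)%N -> y (r - k)%N = (ij.2 == pq.2)%:R.
  move=> kl; have h : (r - l <= r - k <= r)%N by rewrite leq_sub2l ?leq_subr.
  have [q' hq'] := grid_refine n_dvd q h.
  by rewrite /y -hq -hq' lambda_Dhat // leq_subr.
rewrite -(boolean_sum lr hx hy) /Defs.Phi lambda2B.
have sumE (I : finType) (F : I -> R * R -> R^o) :
    lambda2 ij.1 ij.2 (\sum_k F k) = \sum_k lambda2 ij.1 ij.2 (F k).
  under eq_bigr do rewrite -[F _]scale1r.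
  by rewrite lambda2_sum; under eq_bigr do rewrite mul1r.
by rewrite !sumE; congr (_ - _); apply: eq_bigr => k _; rewrite lambda2_tensor.
Qed.

(** As [Phi] vanishes off [Gmn r m n], the sum extends to all pairs of indices,
    where it factors into one-variable projections of [f] and [g]. *)
Lemma tensor_reproduce (l : nat) (f g : R -> R^o) : (l <= r)%N ->
  Pi R (m l) f -> Pi R (n (r - l)%N) g ->
  tensor f g = \sum_(ij in Gmn r m n)
    (lambda a b (m r) ij.1 f * lambda c d (n r) ij.2 g) *: Phi ij.
Proof.
move=> lr fPi gPi; apply/funext => z; rewrite fct_sumE.
pose x k := \sum_i lambda a b (m r) i f * Dhat a b m r k i z.1.
pose y k := \sum_j lambda c d (n r) j g * Dhat c d n r k j z.2.
have hx k : (l <= k <= r)%N -> x k = f z.1.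
  move=> lkr; have kr : (k <= r)%N by case/andP: lkr.
  rewrite [in RHS](Dhat_reproduce ab m_gt0 m_dvd kr (f := f)) ?fct_sumE //.
  exact: Pi_le (degree_le m_gt0 m_dvd lkr) fPi.
have hy k : (k <= l)%N -> y (r - k)%N = g z.2.
  move=> kl; have h : (r - l <= r - k <= r)%N by rewrite leq_sub2l ?leq_subr.
  rewrite [in RHS](Dhat_reproduce cd n_gt0 n_dvd (leq_subr k r) (f := g)) ?fct_sumE //.
  exact: Pi_le (degree_le n_gt0 n_dvd h) gPi.
rewrite /tensor -(boolean_sum lr hx hy).
have swap N (u v : nat -> nat) : \sum_(k < N) x (u k) * y (v k) =
    \sum_ij lambda a b (m r) ij.1 f * lambda c d (n r) ij.2 g *
      \sum_(k < N) Dhat a b m r (u k) ij.1 z.1 * Dhat c d n r (v k) ij.2 z.2.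
  under [RHS]eq_bigr do rewrite mulr_sumr.
  rewrite exchange_big; apply: eq_bigr => k _.
  rewrite /x /y big_distrlr pair_big; apply: eq_bigr => ij _.
  by rewrite mulrACA.
rewrite (swap r.+1 id (fun k => r - k)%N) (swap r id (fun k => r - k - 1)%N).
rewrite -sumrB [RHS]big_mkcond; apply: eq_bigr => ij _.
rewrite -mulrBr -PhiE; case: ifPn => // /Phi_notin->.
exact: mulr0.
Qed.

Lemma Smn_tensor (l : nat) (f g : R -> R^o) : (l <= r)%N ->
  Pi R (m l) f -> Pi R (n (r - l)%N) g -> Smn R r m n (tensor f g).
Proof.
move=> lr fPi gPi; pose l' : 'I_r.+1 := Ordinal (lr : (l < r.+1)%N).
exists (fun k => if k == l' then tensor f g else 0).
  move=> k; case: eqP => [->|_]; first exact: Pi2_tensor.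
  exists (fun _ => 0); rewrite big1 // => ij _; exact: scale0r.
by rewrite (bigD1 l') //= eqxx big1 ?addr0 // => k /negPf->.
Qed.

Lemma Phi_Smn (ij : 'I_(m r).+1 * 'I_(n r).+1) : Smn R r m n (Phi ij).
Proof.
pose F (k : 'I_r.+1 + 'I_r) : R * R -> R^o :=
  match k with
  | inl k => tensor (Dhat a b m r k ij.1) (Dhat c d n r (r - k) ij.2)
  | inr k => tensor (Dhat a b m r k ij.1) (Dhat c d n r (r - k - 1) ij.2)
  end.
have -> : Phi ij = \sum_k (if k is inl _ then 1 else -1) *: F k.
  rewrite big_sumType /= /Defs.Phi -sumrN.
  by congr (_ + _); apply: eq_bigr => k _; rewrite ?scale1r ?scaleN1r.
apply: Smn_sum => -[k|k] _; apply: (Smn_tensor (l := k)) => /=.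
- by rewrite -ltnS.
- by apply: Dhat_Pi => //; rewrite -ltnS.
- by apply: Dhat_Pi => //; rewrite leq_subr.
- exact: ltnW.
- by apply: Dhat_Pi => //; apply: ltnW.
- have h : (r - k - 1 <= r - k <= r)%N by rewrite !leq_subr.
  apply: Pi_le (degree_le n_gt0 n_dvd h) _; apply: Dhat_Pi => //.
  by case/andP: h; apply: leq_trans.
Qed.

Lemma Phi_basis : is_basis (Gmn r m n) Phi (Smn R r m n).
Proof.
split.
  move=> e e0 ij ijG; have := congr1 (lambda2 ij.1 ij.2) e0.
  rewrite lambda2_sum (bigD1 ij) //= lambda2_Phi // !eqxx !mulr1.
  rewrite big1 ?addr0 => [->|pq /andP[_ pqij]]; last first.
    by rewrite lambda2_Phi // -natrM mulnb -xpair_eqE -!surjective_pairing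
      eq_sym (negPf pqij) mulr0.
  by rewrite /Defs.lambda2 big1 // => s _; rewrite big1 // => t _; rewrite mulr0.
apply/seteqP; split => F.
  by move=> [e ->]; apply: Smn_sum => ij _; apply: Phi_Smn.
move=> [H HPi2 ->]; under eq_bigr do rewrite -[H _]scale1r.
apply: lin_span_sum => k _; have [e ->] := HPi2 k.
apply: lin_span_sum => ij _.
have -> : monomial2 ij = tensor (fun x : R => x ^+ ij.1) (fun x : R => x ^+ ij.2).
  by [].
rewrite (tensor_reproduce (l := k)); [|by rewrite -ltnS| |].
- by exists (fun ij' => lambda a b (m r) ij'.1 (fun x => x ^+ ij.1) *
            lambda c d (n r) ij'.2 (fun x => x ^+ ij.2)).
- by apply: Pi_power; rewrite -ltnS.
- by apply: Pi_power; rewrite -ltnS.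
Qed.

End Bivariate.

Unset Implicit Arguments.

Theorem theorem5p3 (R : realType) (r : nat) (a b c d : R) (m n : nat -> nat)
  (hab : a < b) (hcd : c < d)
  (m_gt0 : forall k : nat, (k <= r)%N -> (0 < m k)%N)
  (n_gt0 : forall k : nat, (k <= r)%N -> (0 < n k)%N)
  (m_incr : forall k : nat, (k < r)%N -> (m k < m k.+1)%N)
  (n_incr : forall k : nat, (k < r)%N -> (n k < n k.+1)%N)
  (m_dvd : forall k : nat, (k < r)%N -> (m k %| m k.+1)%N)
  (n_dvd : forall k : nat, (k < r)%N -> (n k %| n k.+1)%N) :
  is_basis (Gmn r m n) (Phi a b c d r m n) (Smn R r m n) /\
  (forall ij pq : 'I_(m r).+1 * 'I_(n r).+1,
     ij \in Gmn r m n -> pq \in Gmn r m n ->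
     lambda2 a b c d (m r) (n r) ij.1 ij.2 (Phi a b c d r m n pq) =
       (ij.1 == pq.1)%:R * (ij.2 == pq.2)%:R).
Proof.
by split=> [|ij pq ijG _]; [apply: Phi_basis|apply: lambda2_Phi].
Qed.
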